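(* Let $\mathbb K$ be an algebraically closed field of characteristic zero, let $f(X)=X^r+a_{r-1}X^{r-1}+\dots+a_0\in\mathbb K[X]$ with $r>1$, and let $\varphi(X,Z)=Z^d+b_{d-1}(X)Z^{d-1}+\dots+b_1(X)Z+b_0(X)\in\mathbb K[X][Z]$ with $d>1$. Let $\mathcal B=\mathbb K[X,Y,Z]/(f(X)Y-\varphi(X,Z))$ and let $x$ be the image of $X$ in $\mathcal B$. Then $ML(\mathcal B)=\mathbb K[x]$.
   Context: For a commutative ring $A$ with unity of characteristic zero, a derivation $D:A\to A$ is called locally nilpotent if for each $a\in A$ there is $n\in\mathbb N$ with $D^n(a)=0$. $ML(A)$ (the $ML$-invariant, or ring of absolute constants) is the intersection of the kernels of all locally nilpotent derivations of $A$. *)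

(* Defs.v *)
From HB Require Import structures.
From mathcomp Require Import all_boot all_order all_algebra.
From mathcomp Require Import boolp classical_sets.

Set Implicit Arguments.
Unset Strict Implicit.
Unset Printing Implicit Defensive.

Import GRing.Theory.
Local Open Scope ring_scope.
Local Open Scope classical_set_scope.
Local Open Scope quotient_scope.

Section MLInvariant.
Variable A : comNzRingType.

Definition derivation (D : A -> A) : Prop :=
  {morph D : a b / a + b} /\ (forall a b, D (a * b) = D a * b + a * D b).

Definition locally_nilpotent (D : A -> A) : Prop :=
  forall a, exists n : nat, iter n D a = 0.

Definition ML : set A :=
  [set a | forall D, derivation D -> locally_nilpotent D -> D a = 0].

End MLInvariant.

Arguments ML : clear implicits.

Section PrincipalQuotient.
Variable R : comNzRingType.

(* [{ideal_quot _}] is only a ring for proper ideals, so the quotient R / (g)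
   carries a proof that g is not invertible. *)
Definition principal_ideal (g : R) of (forall q, q * g != 1) : {pred R} :=
  fun p => `[< exists q, p = q * g >].

Variables (g : R) (g_proper : forall q, q * g != 1).

Lemma principal_idealP p :
  reflect (exists q, p = q * g) (p \in principal_ideal g_proper).
Proof. exact: asboolP. Qed.

Fact principal_ideal_closed : idealr_closed (principal_ideal g_proper).
Proof.
split.
- by apply/principal_idealP; exists 0; rewrite mul0r.
- by apply/principal_idealP => -[q /esym/eqP]; apply/negP.
move=> c u v /principal_idealP[p ->] /principal_idealP[q ->].
by apply/principal_idealP; exists (c * p + q); rewrite mulrDl mulrA.
Qed.

HB.instance Definition _ :=
  isIdealr.Build R (principal_ideal g_proper) principal_ideal_closed.

Lemma principal_quot_eq0 (p : R) :
  \pi_{ideal_quot (principal_ideal g_proper)} p = 0 <-> exists q, p = q * g.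
Proof.
rewrite (rwP eqP) -(rmorph0 \pi_{ideal_quot (principal_ideal g_proper)}).
rewrite -Quotient.idealrBE subr0.
by split=> /principal_idealP.
Qed.

End PrincipalQuotient.

Definition monic_poly (R : nzRingType) (n : nat) (c : 'I_n -> R) : {poly R} :=
  'X^n + \sum_(i < n) c i *: 'X^i.

Lemma size_monic_poly (R : nzRingType) n (c : 'I_n -> R) :
  size (monic_poly c) = n.+1.
Proof.
rewrite /monic_poly size_polyDl ?size_polyXn // ltnS.
apply: (leq_trans (size_sum _ _ _)); apply/bigmax_leqP => i _.
by rewrite (leq_trans (size_scale_leq _ _)) // size_polyXn.
Qed.

(* K[X,Y,Z] is encoded as K[X][Y][Z] = {poly {poly {poly K}}}: X is the
   innermost variable 'X%:P%:P, Y is 'X%:P and Z is 'X. The coefficients of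
   phi in K[X][Z] are lifted from K[X] to K[X][Y] by [map_poly polyC]. *)
Section Danielewski.
Variables (K : closedFieldType) (f : {poly K}).

Definition danielewski_poly (phi : {poly {poly K}}) : {poly {poly {poly K}}} :=
  f%:P%:P * 'X%:P - map_poly polyC phi.

Variables (d : nat) (b : 'I_d -> {poly K}) (d_gt1 : (1 < d)%N).

Lemma danielewski_proper q : q * danielewski_poly (monic_poly b) != 1.
Proof.
have sg : size (danielewski_poly (monic_poly b)) = d.+1.
  rewrite /danielewski_poly addrC -polyCM size_polyDl size_polyN.
    by rewrite size_map_inj_poly ?size_monic_poly //; exact: polyC_inj.
  rewrite size_map_inj_poly ?size_monic_poly //; last exact: polyC_inj.
  by rewrite (leq_ltn_trans (size_polyC_leq1 _)) // ltnS (ltn_trans _ d_gt1).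
apply/eqP => qg1; have := congr1 (size : {poly {poly {poly K}}} -> nat) qg1.
have g0 : danielewski_poly (monic_poly b) != 0 by rewrite -size_poly_gt0 sg.
have [q0|q0] := eqVneq q 0; first
  by move/eqP: qg1; rewrite q0 mul0r eq_sym oner_eq0.
rewrite size_mul // sg size_poly1 addnS /=.
by move: q0; rewrite -size_poly_gt0; case: (size q) d_gt1 => // -[|m]; case: d => [|[]].
Qed.

Definition danielewski_ring : comNzRingType :=
  {ideal_quot (principal_ideal danielewski_proper)}.

Definition danielewski_proj : {poly {poly {poly K}}} -> danielewski_ring :=
  fun p => \pi p.

Definition danielewski_const (c : K) : danielewski_ring :=
  danielewski_proj c%:P%:P%:P.

Definition danielewski_x : danielewski_ring := danielewski_proj 'X%:P%:P.

Definition danielewski_Kx : set danielewski_ring :=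
  range (fun p : {poly K} => (map_poly danielewski_const p).[danielewski_x]).

End Danielewski.

Arguments danielewski_ring {K} f {d} b d_gt1.
Arguments danielewski_Kx {K} f {d} b d_gt1.

(* Main.v *)
Require Import Defs.
From HB Require Import structures.
From mathcomp Require Import all_boot all_order all_algebra.
From mathcomp Require Import boolp classical_sets.
From mathcomp Require Import zify ring.

(** Write x, y, z for the images of X, Y, Z, and r, d for the degrees of f and
    of phi in Z. Since phi is monic in Z, B embeds in K(x)[z] with
    y = phi(x,z) / f(x), and every element of B is uniquely a sum of terms
    p(x) y^j z^i with i < d.

    ML(B) is contained in K[x]: the derivation with x |-> 0, z |-> f and
    y |-> d phi / dz is f d/dz on K(x)[z]. It is triangular, hence locally
    nilpotent ([triangular_nilpotent]), and its kernel is the intersection of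
    B with K(x), which is K[x] ([triangular_kernel]).

    K[x] is contained in ML(B): let D be locally nilpotent. It kills the units
    of the domain B, in particular K, so it remains to show D x = 0
    ([derivation_x0]). Give a nonzero b in K(x)[z] the bidegree (u, w), where
    w is its degree in z and u the degree in x of its leading coefficient
    (u may be negative), and compare bidegrees lexicographically with z first.
    This is a degree function with one-dimensional graded pieces, and since
    the terms p(x) y^j z^i have distinct degrees in z for distinct (i, j), the
    bidegrees of elements of B satisfy u + r * (w div d) >= 0
    ([leading_range]).

    By the chain rule D b = (db/dx) D x + (db/dz) D z, so D has a leading part:
    there are a shift e = (ex, ez) and scalars lx, lz, not both zero, such that
    D sends an element with leading term c x^u z^w to one with leading term
    c (u lx + w lz) x^(u + ex) z^(w + ez) ([leading_derivation]). If D x != 0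
    then ez >= 0, because D x has nonnegative degree in z. Local nilpotency
    says that, starting from x, z or y, the weight u lx + w lz vanishes after
    finitely many shifts by e ([leading_iter]). So lx, lz and
    d lz - r lx are natural multiples j, k, l of minus the weight of e, which
    gives d k = r j + l and ex j + ez k = -1. The constraint on bidegrees
    applied to D x and D z makes this impossible when r, d > 1
    ([no_nonnegative_shift]). *)

Set Implicit Arguments.
Unset Strict Implicit.
Unset Printing Implicit Defensive.

Import Order.TTheory GRing.Theory Num.Theory.
Local Open Scope ring_scope.

(** * Locally nilpotent derivations *)
Section Derivations.
Variables (A : comNzRingType) (D : A -> A).
Hypothesis derD : derivation D.

Lemma derivationD a b : D (a + b) = D a + D b.
Proof. exact: derD.1. Qed.

Lemma derivationM a b : D (a * b) = D a * b + a * D b.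
Proof. exact: derD.2. Qed.

Lemma derivation0 : D 0 = 0.
Proof. by apply: (addrI (D 0)); rewrite -derivationD !addr0. Qed.

Lemma derivation1 : D 1 = 0.
Proof.
have := derivationM 1 1; rewrite !mulr1 mul1r => D11.
by apply: (addrI (D 1)); rewrite -D11 addr0.
Qed.

Lemma derivation_exp a n : a * D (a ^+ n) = (D a * a ^+ n) *+ n.
Proof.
elim: n => [|n IHn]; first by rewrite derivation1 mulr0 mulr0n.
rewrite !exprS derivationM IHn mulrS -mulr_natr.
by move: (D a) (a ^+ n) => u v; rewrite -[_ *+ n]mulr_natr; ring.
Qed.

Lemma iter_derivation0 n : iter n D 0 = 0.
Proof. by elim: n => //= n ->; exact: derivation0. Qed.

Lemma iter_derivationD n a b : iter n D (a + b) = iter n D a + iter n D b.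
Proof. by elim: n a b => //= n IHn a b; rewrite IHn derivationD. Qed.

Lemma iter_derivation_eq0 m n a : (m <= n)%N -> iter m D a = 0 -> iter n D a = 0.
Proof. by move=> /subnK <- am0; rewrite iterD am0 iter_derivation0. Qed.

(** The one surviving term of the iterated Leibniz rule: the degree of
    nilpotency of a product is the sum of those of the factors, provided that
    the product of the top iterates does not vanish. *)
Lemma iter_derivationM_top m n a b :
    iter m.+1 D a = 0 -> iter n.+1 D b = 0 ->
  iter (m + n) D (a * b) = (iter m D a * iter n D b) *+ 'C(m + n, m).
Proof.
have [k le_k] := ubnP (m + n); elim: k => // k IHk in m n a b le_k *.
case: m n => [|m] [|n] in le_k * => am0 bn0; first by rewrite bin0.
- have am1 : D a = 0 := am0.
  have bn1 : iter n.+1 D (D b) = 0 by rewrite -iterSr.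
  have := IHk 0%N n a (D b) _ am0 bn1; rewrite !bin0 -iterSr => <-; last by lia.
  by rewrite add0n iterSr derivationM am1 mul0r add0r.
- have bn1 : D b = 0 := bn0.
  have am1 : iter m.+1 D (D a) = 0 by rewrite -iterSr.
  have := IHk m 0%N (D a) b _ am1 bn0.
  rewrite !addn0 !binn -iterSr => <-; last by lia.
  by rewrite iterSr derivationM bn1 mulr0 addr0.
rewrite addSn iterSr derivationM iter_derivationD IHk; try lia; first last.
- exact: bn0.
- by rewrite -iterSr.
rewrite addnS -addSn IHk; try lia; first last.
- by rewrite -iterSr.
- exact: am0.
by rewrite -!iterSr addSn -addnS binS mulrnDr addrC addnS -addSn.
Qed.

(** In a domain of characteristic zero degrees of nilpotency add up, and that
    of 1 is 0, so both factors of 1 have degree 0. *)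
Lemma locally_nilpotent_unit a b :
    (forall u v : A, u * v = 0 -> u = 0 \/ v = 0) ->
    (forall (u : A) n, u *+ n.+1 = 0 -> u = 0) ->
    locally_nilpotent D -> a * b = 1 -> D a = 0.
Proof.
move=> domA char0 nilD ab1.
have order_top c : c != 0 -> exists2 m, iter m D c != 0 & iter m.+1 D c = 0.
  move=> c0; have exn : exists n, iter n D c == 0 by have [n /eqP] := nilD c; exists n.
  case: (ex_minnP exn) => -[|m] /eqP cm0 min_m; first by rewrite (cm0 : c = 0) eqxx in c0.
  by exists m => //; apply/negP => /min_m; rewrite ltnn.
have [a0 b0] : a != 0 /\ b != 0.
  by split; apply/eqP => c0; move/eqP: ab1; rewrite c0 ?mulr0 ?mul0r eq_sym oner_eq0.
(* If D a != 0, the top term of D^(m + 1 + n) (a * b) = 0 is a nonzero multiple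
   of a product of nonzero elements. *)
have [[|m] am am0] := order_top a a0; first by [].
have [n bn bn0] := order_top b b0.
have := iter_derivationM_top am0 bn0.
rewrite ab1 addSn iterSr derivation1 iter_derivation0 => /esym.
have: (0 < 'C((m + n).+1, m.+1))%N by rewrite bin_gt0; lia.
by case: 'C(_, _) => // k _ /char0 /domA [] /eqP; apply/contraTeq.
Qed.

Lemma iter_derivationM_eq0 m n a b :
  iter m D a = 0 -> iter n D b = 0 -> iter (m + n) D (a * b) = 0.
Proof.
have [k le_k] := ubnP (m + n); elim: k => // k IHk in m n a b le_k *.
case: m n => [|m] [|n] in le_k * => am0 bn0.
- by rewrite (am0 : a = 0) mul0r.
- by rewrite (am0 : a = 0) mul0r iter_derivation0.
- by rewrite (bn0 : b = 0) mulr0 iter_derivation0.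
rewrite addSn iterSr derivationM iter_derivationD IHk ?add0r; try lia; first last.
- exact: bn0.
- by rewrite -iterSr.
by rewrite addnS -addSn IHk //; first lia; rewrite -iterSr.
Qed.

Lemma nilpotent_sum (I : Type) (s : seq I) (F : I -> A) :
    (forall i, exists n, iter n D (F i) = 0) ->
  exists n, iter n D (\sum_(i <- s) F i) = 0.
Proof.
move=> nilF; elim: s => [|i s [n IHs]]; first by exists 0%N; rewrite big_nil.
have [m Fi0] := nilF i; exists (maxn m n); rewrite big_cons iter_derivationD.
by rewrite (iter_derivation_eq0 (leq_maxl m n) Fi0)
  (iter_derivation_eq0 (leq_maxr m n) IHs) addr0.
Qed.

Lemma nilpotent_exp a n :
  (exists m, iter m D a = 0) -> exists m, iter m D (a ^+ n) = 0.
Proof.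
move=> [m am0]; elim: n => [|n [k IHn]]; first by exists 1%N; rewrite /= derivation1.
by exists (m + k)%N; rewrite exprS iter_derivationM_eq0.
Qed.

End Derivations.

(** Chain rule in two variables. *)
Lemma derivation_poly2 (R : comNzRingType) (B : comNzRingType)
    (h : {rmorphism {poly {poly R}} -> B}) (D : B -> B) :
    derivation D -> (forall c, D (h c%:P%:P) = 0) ->
  forall P, D (h P) = h (map_poly deriv P) * D (h 'X%:P) + h P^`() * D (h 'X).
Proof.
move=> derD Dc; have DM := derivationM derD; have DD := derivationD derD.
have D1 (p : {poly R}) : D (h p%:P) = h (p^`())%:P * D (h 'X%:P).
  elim/poly_ind: p => [|p c IHp].
    by rewrite polyC0 rmorph0 (derivation0 derD) deriv0 polyC0 rmorph0 mul0r.
  rewrite polyCD polyCM rmorphD rmorphM /= DD DM Dc addr0 IHp.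
  rewrite derivD derivM derivC derivX addr0 mulr1 polyCD polyCM !(rmorphD, rmorphM) /=.
  ring.
elim/poly_ind => [|P c IHP].
  by rewrite map_poly0 deriv0 rmorph0 (derivation0 derD) !mul0r addr0.
have -> : map_poly deriv (P * 'X + c%:P) = map_poly deriv P * 'X + (c^`())%:P.
  apply/polyP => i; rewrite coef_map !coefD !coefMX coef_map !coefC /=.
  by case: i => [|i] /=; rewrite derivD ?deriv0.
have -> : (P * 'X + c%:P)^`() = P^`() * 'X + P.
  by rewrite derivD derivM derivC derivX addr0 mulr1.
rewrite !(rmorphD, rmorphM) /= DD DM (D1 c) IHP; ring.
Qed.

(** * Top coefficients of polynomials *)
Lemma coefM_top (R : nzRingType) (p q : {poly R}) m n :
  (size p <= m.+1)%N -> (size q <= n.+1)%N -> (p * q)`_(m + n) = p`_m * q`_n.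
Proof.
move=> sp sq; have lt_m : (m < (m + n).+1)%N by rewrite ltnS leq_addr.
rewrite coefM (bigD1 (Ordinal lt_m)) //= addKn big1 ?addr0 // => -[i /= ltimn].
rewrite -val_eqE /= neq_ltn => /orP[ltim|ltmi].
  by rewrite (nth_default 0 (s := q)) ?mulr0 // (leq_trans sq) //; lia.
by rewrite (nth_default 0 (s := p)) ?mul0r // (leq_trans sp).
Qed.

Lemma size_mul_top (R : nzRingType) (p q : {poly R}) m n :
  (size p <= m.+1)%N -> (size q <= n.+1)%N -> (size (p * q)%R <= (m + n).+1)%N.
Proof. by move=> sp sq; rewrite (leq_trans (size_polyMleq _ _)) //; lia. Qed.

Lemma size_deriv_top (R : nzRingType) (p : {poly R}) m :
  (size p <= m.+1)%N -> (size p^`() <= m)%N.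
Proof.
move=> sp; apply/leq_sizeP => i lemi; rewrite coef_deriv nth_default ?mul0rn //.
by rewrite (leq_trans sp).
Qed.

(** * The numerical obstruction *)

(** Write ez = q d + t with t < d. Since k d = r j + l, the quantity
    ex j + ez k equals (ex + r q) j + q l + t k, which has to be -1.
    If t < d - 1 the last hypothesis bounds ex + r q below by 0. If t = d - 1,
    the hypothesis before it gives only ex + r q >= -1, but then
    t k = (d - 1) k >= (d / 2) k >= (r / 2) j >= j compensates; this is where
    both r > 1 and d > 1 enter. *)
Lemma no_nonnegative_shift (r d j k l ez : nat) (ex : int) :
    (1 < r)%N -> (1 < d)%N -> (d * k = r * j + l)%N ->
    ex * j%:Z + ez%:Z * k%:Z = -1 ->
    ((0 < j)%N -> 0 <= ex + 1 + (r * (ez %/ d))%:Z) ->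
    ((0 < k)%N -> 0 <= ex + (r * (ez.+1 %/ d))%:Z) -> False.
Proof.
move=> r2 d2 edk ekj xS zS.
have j0 : (0 < j)%N by case: j ekj {edk xS} => //; nia.
have k0 : (0 < k)%N by nia.
move/(_ j0): xS => xS; move/(_ k0): zS => zS.
have td : (ez %% d < d)%N by rewrite ltn_mod; lia.
have ez_eq := divn_eq ez d; set q := (ez %/ d)%N in ez_eq xS *.
set t := (ez %% d)%N in ez_eq td.
have eqd : q%:Z * d%:Z * k%:Z = q%:Z * (r%:Z * j%:Z + l%:Z) by nia.
have ezk : ez%:Z * k%:Z = q%:Z * (r%:Z * j%:Z + l%:Z) + t%:Z * k%:Z by nia.
have [lt_t|ge_t] := ltnP t.+1 d.
  have eq1 : (ez.+1 %/ d)%N = q by rewrite ez_eq -addnS divnMDl ?divn_small ?addn0; lia.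
  rewrite eq1 in zS.
  have : 0 <= (ex + (r * q)%:Z) * j%:Z by rewrite mulr_ge0.
  have : 0 <= q%:Z * l%:Z by rewrite mulr_ge0.
  have : 0 <= t%:Z * k%:Z by rewrite mulr_ge0.
  nia.
have et : t = d.-1 by lia.
have jk : (j <= t * k)%N by nia.
have : 0 <= (ex + 1 + (r * q)%:Z) * j%:Z by rewrite mulr_ge0.
have : 0 <= q%:Z * l%:Z by rewrite mulr_ge0.
nia.
Qed.

(** * The semigroup of bidegrees *)

(** The presentation of B is used only through an embedding iota of K[X][Z]
    and an element y with f y = phi such that every element is a polynomial in
    y whose coefficients have degree less than d in Z. *)
Section ReducedForms.
Variables (K : fieldType) (r d : nat) (f : {poly K}) (phi : {poly {poly K}}).
Variables (B : comNzRingType) (iota : {rmorphism {poly {poly K}} -> B}) (y : B).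
Hypotheses (r_gt1 : (1 < r)%N) (d_gt1 : (1 < d)%N).
Hypotheses (f_monic : f \is monic) (size_f : size f = r.+1).
Hypotheses (phi_monic : phi \is monic) (size_phi : size phi = d.+1).
Hypotheses (iota_inj : injective iota) (iota_phi : iota f%:P * y = iota phi).
Hypothesis reduced : forall b, exists2 W : {poly {poly {poly K}}},
  (forall j, (size (W`_j)%R <= d)%N) & b = (map_poly iota W).[y].

Let r_gt0 : (0 < r)%N := ltnW r_gt1.
Let d_gt0 : (0 < d)%N := ltnW d_gt1.
Local Notation x := (iota 'X%:P).
Local Notation z := (iota 'X).

Lemma size_phiX n : size (phi ^+ n) = (d * n).+1.
Proof.
by rewrite -[LHS]prednK ?size_exp ?size_phi // size_poly_gt0 monic_neq0 ?monic_exp.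
Qed.

(** Every element is a fraction P(x,z) / f^n, and its bidegree is that of the
    last term W_J y^J of its reduced form: the earlier terms have degree less
    than d J in z, whereas f^J W_J y^J = W_J phi^J has degree at least d J. *)
Lemma clear_denominators b : b = 0 \/ exists n P,
  [/\ P != 0, iota f%:P ^+ n * b = iota P
    & (n * r <= (size (lead_coef P)).-1 + r * ((size P).-1 %/ d))%N].
Proof.
have [W szW ->] := reduced b.
have [->|W0] := eqVneq W 0; first by left; rewrite map_poly0 horner0.
right; pose J := (size W).-1; have WJ0 : W`_J != 0 by rewrite -lead_coefE lead_coef_eq0.
have sW : size W = J.+1 by rewrite prednK // size_poly_gt0.
pose term j := f ^+ (J - j) *: (W`_j * phi ^+ j).
have sz_term j : (size (term j) <= d * j.+1)%N.
  rewrite (leq_trans (size_scale_leq _ _)) // (leq_trans (size_polyMleq _ _)) //.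
  by rewrite size_phiX addnS /= mulnS leq_add2r.
pose P0 := \sum_(j < J) term j.
have sz_P0 : (size P0 <= d * J)%N.
  apply: (leq_trans (size_sum _ _ _)); apply/bigmax_leqP => j _.
  by rewrite (leq_trans (sz_term j)) // leq_pmul2l.
have sz_top : size (W`_J * phi ^+ J) = (size (W`_J)%R + d * J)%N.
  by rewrite size_Mmonic ?monic_exp // size_phiX addnS.
have sWJ : (0 < size (W`_J)%R)%N by rewrite size_poly_gt0.
have lt_P0 : (size P0 < size (W`_J * phi ^+ J)%R)%N by rewrite sz_top; lia.
have szP : size (P0 + W`_J * phi ^+ J) = (size (W`_J)%R + d * J)%N.
  by rewrite addrC size_polyDl.
exists J, (P0 + W`_J * phi ^+ J); split.
- by rewrite -size_poly_gt0 szP addn_gt0 sWJ.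
- have termE j : (j <= J)%N -> iota (term j) = iota f%:P ^+ J * (iota W`_j * y ^+ j).
    move=> lejJ; rewrite /term -mul_polyC rmorphM rmorphXn rmorphM !rmorphXn /=.
    rewrite -iota_phi exprMn -{2}(subnK lejJ) exprD; ring.
  rewrite horner_coef size_map_inj_poly ?rmorph0 // sW big_distrr /= big_ord_recr /=.
  rewrite rmorphD rmorph_sum /=; congr (_ + _).
    by apply: eq_bigr => j _; rewrite termE ?coef_map //; apply: ltnW.
  by rewrite coef_map -termE // /term subnn expr0 scale1r.
rewrite lead_coefDr // szP lead_coef_Mmonic ?monic_exp //.
have -> : ((size (W`_J)%R + d * J).-1 = J * d + (size (W`_J)%R).-1)%N by lia.
rewrite divnMDl // divn_small ?addn0; last by rewrite prednK.
by rewrite mulnC leq_addl.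
Qed.

Lemma iota_fX n : iota f%:P ^+ n = iota (f ^+ n)%:P.
Proof. by rewrite rmorphXn rmorphXn. Qed.

Lemma f_regular n b : iota f%:P ^+ n * b = 0 -> b = 0.
Proof.
case: (clear_denominators b) => // -[m [P [P0 fb _]]] fb0.
have: iota (f%:P ^+ n * P) = 0 by rewrite rmorphM rmorphXn -fb /= mulrCA fb0 mulr0.
rewrite -[0 in RHS](rmorph0 iota) => /iota_inj/eqP; rewrite mulf_eq0 (negPf P0) orbF.
by rewrite expf_eq0 polyC_eq0 (negPf (monic_neq0 f_monic)) andbF.
Qed.

Lemma quotient_domain (a b : B) : a * b = 0 -> a = 0 \/ b = 0.
Proof.
move=> ab0; case: (clear_denominators a) => [|[m [P [P0 fa _]]]]; first by left.
case: (clear_denominators b) => [|[n [Q [Q0 fb _]]]]; first by right.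
have: iota (P * Q) = 0 by rewrite rmorphM -fa -fb mulrACA ab0 mulr0.
rewrite -[0 in RHS](rmorph0 iota) => /iota_inj/eqP.
by rewrite mulf_eq0 (negPf P0) (negPf Q0).
Qed.

(** As an element of K(x)[z], b has bidegree at most (u, w) in the z-first
    lexicographic order, and coefficient c at that bidegree. The value c = 0 is
    allowed, so that the property is stable under sums and under derivations
    whatever cancels. Membership in K(x)[z] is expressed by a fraction
    P(x,z) / f^n, with u = m - n r since f has degree r. *)
Definition leading (b : B) (u : int) (w : nat) (c : K) : Prop :=
  exists (n m : nat) (P : {poly {poly K}}),
  [/\ u = m%:Z - (n * r)%:Z, iota f%:P ^+ n * b = iota P,
      (size P <= w.+1)%N, (size (P`_w)%R <= m.+1)%N & P`_w`_m = c].

Lemma leading_iota (P : {poly {poly K}}) m w :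
    (size P <= w.+1)%N -> (size (P`_w)%R <= m.+1)%N ->
  leading (iota P) m w P`_w`_m.
Proof. by exists 0%N, m, P; split=> //; rewrite ?mul0n ?subr0 // expr0 mul1r. Qed.

Lemma leading_y : leading y (- r%:Z) d 1.
Proof.
exists 1%N, 0%N, phi; split; rewrite ?size_phi ?mul1n ?sub0r //.
  by rewrite (_ : phi`_d = 1) ?size_poly1 // -(monicP phi_monic) lead_coefE size_phi.
by rewrite (_ : phi`_d = 1) ?coef1 // -(monicP phi_monic) lead_coefE size_phi.
Qed.

Lemma leading_div k b u w c :
  leading (iota f%:P ^+ k * b) u w c -> leading b (u - (k * r)%:Z) w c.
Proof.
move=> [n [m [P [-> fb sP sPw Pc]]]]; exists (n + k)%N, m, P; split=> //.
  by rewrite mulnDl PoszD opprD addrA.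
by rewrite exprD -mulrA.
Qed.

Lemma fX_top k : size (f ^+ k) = (k * r).+1 /\ (f ^+ k)`_(k * r) = 1.
Proof.
have fk : f ^+ k \is monic by rewrite monic_exp.
have sfk : size (f ^+ k) = (k * r).+1.
  by rewrite -[LHS]prednK ?size_exp ?size_f ?[(r * k)%N]mulnC // size_poly_gt0 monic_neq0.
by split=> //; rewrite -(monicP fk) lead_coefE sfk.
Qed.

Lemma leading_lift k b n m (P : {poly {poly K}}) w c :
    iota f%:P ^+ n * b = iota P -> (size P <= w.+1)%N -> (size (P`_w)%R <= m.+1)%N ->
    P`_w`_m = c -> exists Q,
  [/\ iota f%:P ^+ (k + n) * b = iota Q, (size Q <= w.+1)%N,
      (size (Q`_w)%R <= (k * r + m).+1)%N & Q`_w`_(k * r + m) = c].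
Proof.
move=> fb sP sPw Pc; have [sfk fk1] := fX_top k; exists ((f ^+ k) *: P); split.
- by rewrite exprD -mulrA fb iota_fX -rmorphM mul_polyC.
- by rewrite (leq_trans (size_scale_leq _ _)).
- by rewrite coefZ size_mul_top ?sfk.
by rewrite coefZ coefM_top ?sfk // fk1 mul1r.
Qed.

Lemma leadingD a b u w c e :
  leading a u w c -> leading b u w e -> leading (a + b) u w (c + e).
Proof.
move=> [n [m [P [eu fa sP sPw Pc]]]] [n' [m' [Q [eu' fb sQ sQw Qe]]]].
have [P' [fa' sP' sPw' Pc']] := leading_lift n' fa sP sPw Pc.
have [Q' [fb' sQ' sQw' Qe']] := leading_lift n fb sQ sQw Qe.
have em : (n' * r + m = n * r + m')%N by lia.
exists (n + n')%N, (n * r + m')%N, (P' + Q'); split.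
- by rewrite eu' ; lia.
- by rewrite mulrDr fb' {1}addnC fa' rmorphD.
- by rewrite (leq_trans (size_polyD _ _)) // geq_max sP'.
- by rewrite coefD (leq_trans (size_polyD _ _)) // geq_max -{1}em sPw'.
by rewrite !coefD -{1}em Pc' Qe'.
Qed.

Lemma leadingM a b u w c u' w' e : leading a u w c -> leading b u' w' e ->
  leading (a * b) (u + u') (w + w') (c * e).
Proof.
move=> [n [m [P [-> fa sP sPw Pc]]]] [n' [m' [Q [-> fb sQ sQw Qe]]]].
exists (n + n')%N, (m + m')%N, (P * Q); split.
- by lia.
- by rewrite exprD mulrACA fa fb rmorphM.
- exact: size_mul_top.
- by rewrite coefM_top // size_mul_top.
by rewrite !coefM_top // Pc Qe.
Qed.

Lemma leading0 u w c : leading 0 u w c -> c = 0.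
Proof.
move=> [n [m [P [_ P0 _ _ <-]]]].
have -> : P = 0 by apply: iota_inj; rewrite -P0 mulr0 rmorph0.
by rewrite !coef0.
Qed.

Lemma leading_zero u w : leading 0 u w 0.
Proof.
exists `|u|%N, `|(u + (`|u| * r)%:Z)%R|%N, 0; rewrite mulr0 rmorph0 !coef0 size_poly0.
have := leq_pmulr `|u| r_gt0; rewrite size_poly0; split=> //; lia.
Qed.

Lemma leading_exists b : b != 0 -> exists u w c, c != 0 /\ leading b u w c.
Proof.
case: (clear_denominators b) => [->|[n [P [P0 fb _]]] _]; first by rewrite eqxx.
have lcP0 : lead_coef P != 0 by rewrite lead_coef_eq0.
exists ((size (lead_coef P)).-1%:Z - (n * r)%:Z), (size P).-1, (lead_coef (lead_coef P)).
split; first by rewrite lead_coef_eq0.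
exists n, (size (lead_coef P)).-1, P; rewrite -lead_coefE.
by split=> //; rewrite prednK // size_poly_gt0.
Qed.

Lemma leading_lower_w b u w c u' w' :
  leading b u w c -> (w < w')%N -> leading b u' w' 0.
Proof.
move=> [n [m [P [_ fb sP _ _]]]] ltww'; have Pw' : P`_w' = 0.
  by rewrite nth_default // (leq_trans sP).
have sPw : (size (P`_w')%R <= 1)%N by rewrite Pw' size_poly0.
have Pc : P`_w'`_0 = 0 by rewrite Pw' coef0.
pose k := `|u'|%N; have [|Q [fbQ sQ sQw _]] := leading_lift k fb _ sPw Pc.
  by rewrite (leq_trans sP) // ltnW // ltnS.
have sPQ : (size (f ^+ k *: P)%R <= w')%N.
  by rewrite (leq_trans (size_scale_leq _ _)) // (leq_trans sP).
have Qw : (f ^+ k *: P)`_w' = 0 by rewrite nth_default.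
exists (k + n)%N, `|(u' + ((k + n) * r)%:Z)%R|%N, (f ^+ k *: P).
rewrite Qw coef0 size_poly0; split=> //.
  by have := leq_pmulr (k + n) r_gt0; rewrite /k; lia.
  by rewrite exprD -mulrA fb iota_fX -rmorphM mul_polyC.
by rewrite leqW.
Qed.

Lemma leading_lower_u b u w c u' :
  leading b u w c -> u < u' -> leading b u' w 0.
Proof.
move=> [n [m [P [-> fb sP sPw Pc]]]] ltuu'.
have ltm : (m < `|(m%:Z + (u' - (m%:Z - (n * r)%:Z)))%R|)%N by lia.
exists n, `|(m%:Z + (u' - (m%:Z - (n * r)%:Z)))%R|%N, P.
split=> //; first by lia.
  by rewrite (leq_trans sPw) // ltnS ltnW.
by rewrite nth_default // (leq_trans sPw).
Qed.

(** A nonzero coefficient determines the bidegree of b whatever fraction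
    represents it, so the bound of [clear_denominators] carries over. *)
Lemma leading_range b u w c :
  leading b u w c -> c != 0 -> 0 <= u + (r * (w %/ d))%:Z.
Proof.
move=> [n [m [P [-> fb sP sPw <-]]]] c0.
have Pw0 : P`_w != 0 by apply: contra_neq c0 => ->; rewrite coef0.
have szP : size P = w.+1.
  by apply/anti_leq; rewrite sP; apply: contraNltn Pw0 => ?; rewrite nth_default.
have szPw : size (P`_w)%R = m.+1.
  by apply/anti_leq; rewrite sPw; apply: contraNltn c0 => ?; rewrite nth_default.
case: (clear_denominators b) => [b0|[n' [Q [Q0 fbQ leQ]]]].
  move: fb; rewrite b0 mulr0 -[LHS](rmorph0 iota) => /iota_inj P0.
  by rewrite -P0 coef0 eqxx in Pw0.
have PQ : f ^+ n' *: P = f ^+ n *: Q.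
  by apply: iota_inj; rewrite -!mul_polyC !rmorphM -!iota_fX -fb -fbQ mulrCA.
have [[sfn _] [sfn' _]] := (fX_top n, fX_top n').
have fX0 k : f ^+ k != 0 by rewrite expf_neq0 ?monic_neq0.
have szQ : size Q = w.+1 by rewrite -szP -(size_scale P (fX0 n')) PQ size_scale.
have lcP : f ^+ n' * P`_w = f ^+ n * lead_coef Q.
  by rewrite lead_coefE szQ -!coefZ PQ.
have lcQ0 : lead_coef Q != 0 by rewrite lead_coef_eq0.
have := congr1 (fun p : {poly K} => size p) lcP.
rewrite !size_mul // sfn sfn' szPw; move: leQ; rewrite szQ /=.
have : (0 < size (lead_coef Q))%N by rewrite size_poly_gt0.
move: (size (lead_coef Q)) (n * r)%N (n' * r)%N (r * (w %/ d))%N => s1 s2 s3 s4; lia.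
Qed.

(** * Leading part of a locally nilpotent derivation *)

Hypothesis charK0 : [pchar K] =i pred0.

Lemma natK_eq0 n : (n%:R == 0 :> K) = (n == 0)%N.
Proof. by move/pcharf0P: charK0. Qed.

Lemma intK_eq0 (i : int) : i%:~R = 0 :> K -> i = 0.
Proof.
case: i => n /eqP; first by rewrite -pmulrn natK_eq0 => /eqP->.
by rewrite NegzE mulrNz oppr_eq0 -pmulrn natK_eq0.
Qed.

Section Vanishing.
Variable D : B -> B.
Hypotheses (derD : derivation D) (nilD : locally_nilpotent D).

Lemma derivation_const c : D (iota c%:P%:P) = 0.
Proof.
have [->|c0] := eqVneq c 0; first by rewrite !polyC0 rmorph0 (derivation0 derD).
apply: (@locally_nilpotent_unit _ _ derD _ (iota c^-1%:P%:P)) => //.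
- exact: quotient_domain.
- move=> u n; rewrite -mulr_natr => /quotient_domain [] //.
  rewrite -(rmorph_nat iota) -[0 in RHS](rmorph0 iota) => /iota_inj/eqP.
  by rewrite -!polyC_natr !polyC_eq0 natK_eq0.
by rewrite -rmorphM -!polyCM mulfV // rmorph1.
Qed.

Lemma derivation_iota P :
  D (iota P) = iota (map_poly deriv P) * D x + iota P^`() * D z.
Proof. by apply: derivation_poly2 => //; exact: derivation_const. Qed.

(** This is the x-derivative of p / f^n, multiplied by f^(n + 1): a fraction of
    degree u in x has a derivative of degree u - 1, with leading coefficient
    multiplied by u, also for negative u. *)
Lemma coef_log_deriv (p : {poly K}) m n (q := f * p^`() - (f^`() * p) *+ n) :
    (size p <= m.+1)%N ->
  (size q <= r + m)%N /\ q`_(r + m).-1 = (m%:Z - (n * r)%:Z)%:~R * p`_m.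
Proof.
move=> sp; case: r r_gt0 size_f => // r' _ sf.
have fr : f`_r'.+1 = 1 by rewrite -(monicP f_monic) lead_coefE sf.
have sf' : (size f^`() <= r'.+1)%N by rewrite size_deriv_top ?sf.
have coef2 : (f^`() * p)`_(r' + m) = r'.+1%:R * p`_m.
  by rewrite coefM_top // coef_deriv fr.
have size2 : (size (f^`() * p)%R <= (r' + m).+1)%N by rewrite size_mul_top.
have [size1 coef1] : (size (f * p^`())%R <= (r' + m).+1)%N /\
    (f * p^`())`_(r' + m) = m%:R * p`_m.
  case: m sp {coef2 size2} => [|m] sp.
    have -> : p^`() = 0 by rewrite (size1_polyC sp) derivC.
    by rewrite mulr0 size_poly0 coef0 mul0r.
  have sp' := size_deriv_top sp; rewrite addnS -addSn; split.
    by rewrite size_mul_top ?sf.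
  by rewrite coefM_top ?sf // fr mul1r coef_deriv mulr_natl.
rewrite addSn /= /q; split.
  rewrite (leq_trans (size_polyD _ _)) // geq_max size1 size_polyN.
  by rewrite -scaler_nat (leq_trans (size_scale_leq _ _)).
rewrite coefB coefMn coef1 coef2 rmorphB /= -!pmulrn natrM -[_ *+ n]mulr_natr; ring.
Qed.

Lemma leading_eq b u w c u' w' c' :
  leading b u w c -> u = u' -> w = w' -> c = c' -> leading b u' w' c'.
Proof. by move=> ? <- <- <-. Qed.

(** The leading part of D: (ex, ez) is its shift, lx and lz are its values on the
    exponents of x and z. *)
Section Shift.
Variables (ex : int) (ez : nat) (lx lz : K).
Hypotheses (lead_Dx : leading (D x) (ex + 1) ez lx) (lead_Dz : leading (D z) ex ez.+1 lz).

Definition weight (u w : int) : K := u%:~R * lx + w%:~R * lz.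

(** The chain rule for b = P / f^n, where x d/dx and z d/dz multiply a term of
    bidegree (u, w) by u and by w. *)
Lemma leading_derivation b u w c :
  leading b u w c -> leading (D b) (u + ex) (w + ez) (c * weight u w).
Proof.
move=> [n [m [P [eu fb sP sPw Pc]]]].
pose P1 := f%:P * map_poly deriv P - (f^`()%:P * P) *+ n.
pose P2 := f%:P * P^`().
have Db : iota f%:P ^+ n.+1 * D b = iota P1 * D x + iota P2 * D z.
  have := derivation_exp derD (iota f%:P) n.
  have := derivation_iota P; rewrite -fb (derivationM derD) => DP DX.
  have Df : D (iota f%:P) = iota f^`()%:P * D x.
    by rewrite derivation_iota map_polyC /= derivC rmorph0 mul0r addr0.
  have -> : iota f%:P ^+ n.+1 * D b =
      iota f%:P * (iota f%:P ^+ n * D b + D (iota f%:P ^+ n) * b)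
      - (D (iota f%:P) * (iota f%:P ^+ n * b)) *+ n.
    by rewrite mulrDr [iota f%:P * (D _ * b)]mulrA DX mulrnAl exprS; ring.
  rewrite [X in iota f%:P * X]addrC DP fb Df /P1 /P2 rmorphB rmorphMn !rmorphM /=; ring.
have [sq cq] := coef_log_deriv n sPw.
have P1w : P1`_w = f * (P`_w)^`() - (f^`() * P`_w) *+ n.
  by rewrite coefB coefMn !coefCM coef_map.
have sP1 : (size P1 <= w.+1)%N.
  apply/leq_sizeP => i ltwi; rewrite coefB coefMn !coefCM coef_map /=.
  by rewrite nth_default ?deriv0 ?mulr0 ?mul0rn ?subr0 // (leq_trans sP).
have rm : (r + m).-1.+1 = (r + m)%N by rewrite prednK // addn_gt0 r_gt0.
have lead1 : leading (iota P1 * D x) (m%:Z + r%:Z + ex) (w + ez) (u%:~R * c * lx).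
  apply: (leading_eq (leadingM (leading_iota (m := (r + m).-1) sP1 _) lead_Dx)) => //.
  - by rewrite P1w rm.
  - lia.
  by rewrite P1w cq eu Pc.
have lead2 : leading (iota P2 * D z) (m%:Z + r%:Z + ex) (w + ez) (w%:R * c * lz).
  (* For w = 0 there is no bidegree w - 1, but P does not depend on z. *)
  case: w sP sPw Pc {P1w sP1 lead1 sq cq} => [|w'] sP sPw Pc.
    have -> : P2 = 0 by rewrite /P2 (size1_polyC sP) derivC mulr0.
    by rewrite rmorph0 !mul0r; apply: leading_zero.
  have sP' := size_deriv_top sP.
  have P2w : P2`_w' = f * (P`_w'.+1 *+ w'.+1) by rewrite coefCM coef_deriv.
  have sn : (size (P`_w'.+1 *+ w'.+1)%R <= m.+1)%N.
    by rewrite -scaler_nat (leq_trans (size_scale_leq _ _)).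
  have sP2 : (size P2 <= w'.+1)%N.
    by rewrite /P2 mul_polyC (leq_trans (size_scale_leq _ _)).
  apply: (leading_eq (leadingM (leading_iota (m := r + m) sP2 _) lead_Dz)).
  - by rewrite P2w size_mul_top ?size_f.
  - lia.
  - lia.
  rewrite P2w coefM_top ?size_f //.
  have -> : f`_r = 1 by rewrite -(monicP f_monic) lead_coefE size_f.
  by rewrite mul1r coefMn Pc -[c *+ _]mulr_natl.
have lead12 := leadingD lead1 lead2.
rewrite -Db in lead12; apply: (leading_eq (leading_div lead12)) => //.
  by rewrite eu mulSn; lia.
by rewrite /weight -pmulrn; ring.
Qed.

(** Otherwise no iterate of D on b would lose its leading coefficient, and none
    would vanish. *)
Lemma leading_iter b u w c : leading b u w c -> c != 0 ->
  exists j : nat, weight u w + j%:R * weight ex ez = 0.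
Proof.
move=> lead_b c0; apply: contrapT => no_j.
have [n Dnb0] := nilD b.
suff [e e0] : exists2 e, e != 0 & leading (iter n D b) (u + n%:Z * ex) (w + n * ez) e.
  by rewrite Dnb0 => /leading0/eqP; apply/negP.
elim: n {Dnb0} => [|n [e e0 IHn]].
  by exists c; rewrite // mul0r mul0n addr0 addn0.
exists (e * weight (u + n%:Z * ex) (w + n * ez)%N); last first.
  by apply: (leading_eq (leading_derivation IHn)) => //; rewrite ?mulSn; lia.
rewrite mulf_neq0 //; apply/eqP => we; apply: no_j; exists n.
rewrite -we /weight PoszD PoszM !rmorphD !rmorphM /= -!pmulrn; ring.
Qed.

End Shift.

(** The shift is the larger of bideg (D x) - (1, 0) and bideg (D z) - (0, 1).
    Its second component is a natural number because D x != 0; otherwise it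
    could be -1, as for the triangular derivation below. *)
Lemma shift_exists : D x != 0 -> exists (ex : int) (ez : nat) (lx lz : K),
  [/\ leading (D x) (ex + 1) ez lx, leading (D z) ex ez.+1 lz & (lx != 0) || (lz != 0)].
Proof.
move=> /leading_exists [u1 [w1 [c1 [c10 lead1]]]].
have eu1 : u1 = u1 - 1 + 1 by rewrite subrK.
have first_wins : leading (D z) (u1 - 1) w1.+1 0 ->
  exists (ex : int) (ez : nat) (lx lz : K),
    [/\ leading (D x) (ex + 1) ez lx, leading (D z) ex ez.+1 lz & (lx != 0) || (lz != 0)].
  by exists (u1 - 1), w1, c1, 0; rewrite -eu1 c10.
have [Dz0|/leading_exists [u2 [w2 [c2 [c20 lead2]]]]] := eqVneq (D z) 0.
  by apply: first_wins; rewrite Dz0; apply: leading_zero.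
have [ltw2|ltw1|ew2] := ltngtP w2 w1.+1.
- exact: first_wins (leading_lower_w _ lead2 ltw2).
- exists u2, w2.-1, 0, c2; rewrite c20 orbT; split=> //.
    by apply: leading_lower_w lead1 _ => //; lia.
  by rewrite prednK //; lia.
rewrite ew2 in lead2.
have [ltu|ltu|eu2] := ltgtP u2 (u1 - 1).
- exact: first_wins (leading_lower_u lead2 ltu).
- exists u2, w1, 0, c2; rewrite c20 orbT; split=> //.
  by apply: leading_lower_u lead1 _; lia.
by exists u2, w1, c1, c2; rewrite c10; split=> //; rewrite eu2 subrK.
Qed.

(** The multiplicities j, k, l are the numbers of steps after which the weight
    vanishes starting from x, z and y. *)
Lemma derivation_x0 : D x = 0.
Proof.
apply/eqP/negPn/negP => /shift_exists [ex [ez [lx [lz [lead_Dx lead_Dz l_neq0]]]]].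
pose A := weight lx lz ex ez.
have iter_leading b u w c := @leading_iter _ _ _ _ lead_Dx lead_Dz b u w c.
have lead_x : leading x 1%:Z 0 1.
  have := leading_iota (P := 'X%:P) (m := 1) (w := 0).
  by rewrite coefC eqxx coefX; apply; rewrite ?size_polyX ?size_polyC_leq1.
have lead_z : leading z 0%:Z 1 1.
  have := leading_iota (P := 'X) (m := 0) (w := 1).
  by rewrite coefX eqxx coef1; apply; rewrite ?size_polyX ?size_poly1.
have [j ej] := iter_leading _ _ _ _ lead_x (oner_neq0 K).
have [k ek] := iter_leading _ _ _ _ lead_z (oner_neq0 K).
have [l el] := iter_leading _ _ _ _ leading_y (oner_neq0 K).
rewrite /weight -/A mul0r addr0 mul1r in ej.
rewrite -/A /weight mul0r add0r mul1r in ek.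
have {}ej : lx = - (j%:R * A) by apply/eqP; rewrite -addr_eq0 ej.
have {}ek : lz = - (k%:R * A) by apply/eqP; rewrite -addr_eq0 ek.
have A0 : A != 0.
  by apply: contraTneq l_neq0 => A0; rewrite ej ek A0 !mulr0 oppr0 eqxx.
have e1 : ex * j%:Z + ez%:Z * k%:Z = -1.
  suff : ex * j%:Z + ez%:Z * k%:Z + 1 = 0 by lia.
  apply: intK_eq0; apply: (mulIf A0).
  rewrite mul0r !rmorphD !rmorphM /= -!pmulrn.
  have : A = ex%:~R * lx + ez%:R * lz by rewrite /A /weight -pmulrn.
  by rewrite ej ek => /eqP; rewrite -subr_eq0 => /eqP <-; ring.
have e2 : (d * k = r * j + l)%N.
  suff : r%:Z * j%:Z - d%:Z * k%:Z + l%:Z = 0 by nia.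
  apply: intK_eq0; apply: (mulIf A0); rewrite mul0r -el -/A /weight ej ek.
  rewrite !rmorphD !rmorphN !rmorphM /= -!pmulrn; ring.
apply: (no_nonnegative_shift r_gt1 d_gt1 e2 e1) => [j0|k0].
  apply: leading_range lead_Dx _.
  by rewrite ej oppr_eq0 mulf_eq0 negb_or A0 natK_eq0 -lt0n j0.
apply: leading_range lead_Dz _.
by rewrite ek oppr_eq0 mulf_eq0 negb_or A0 natK_eq0 -lt0n k0.
Qed.

End Vanishing.

(** * The triangular derivation: nilpotency and kernel *)
Section Triangular.
Variable D : B -> B.
Hypothesis derD : derivation D.
Hypothesis D_iota : forall P, D (iota P) = iota (f%:P * P^`()).

Lemma triangular_iota_nilpotent n (P : {poly {poly K}}) :
  (size P <= n)%N -> iter n D (iota P) = 0.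
Proof.
elim: n P => [|n IHn] P sP.
  by move: sP; rewrite leqn0 size_poly_eq0 => /eqP ->; rewrite rmorph0.
rewrite iterSr D_iota IHn // mul_polyC (leq_trans (size_scale_leq _ _)) //.
exact: size_deriv_top.
Qed.

Lemma triangular_nilpotent : D y = iota phi^`() -> locally_nilpotent D.
Proof.
move=> Dy b; have [W _ ->] := reduced b; rewrite horner_coef.
apply: nilpotent_sum => // i; rewrite coef_map /=.
have Wi := triangular_iota_nilpotent (leqnn (size (W`_i))).
have y_nil : exists m, iter m D y = 0.
  exists (size phi^`()).+1; rewrite iterSr Dy.
  exact: triangular_iota_nilpotent.
have [m yi] := nilpotent_exp derD i y_nil.
by exists (size (W`_i)%R + m)%N; apply: iter_derivationM_eq0.
Qed.

(** D b = 0 forces b = p(x) / f^n. Dividing p by f^n, the remainder would be an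
    element of B of bidegree (u, 0) with u < 0, against [leading_range]. *)
Lemma triangular_kernel b : D b = 0 -> exists p, b = iota p%:P.
Proof.
move=> Db; case: (clear_denominators b) => [->|[n [P [P0 fb _]]]].
  by exists 0; rewrite rmorph0.
have Df : D (iota f%:P ^+ n) = 0.
  by rewrite iota_fX D_iota derivC mulr0 rmorph0.
have P'0 : P^`() = 0.
  have : iota (f%:P * P^`()) = 0.
    by rewrite -D_iota -fb derivationM // Df Db mul0r mulr0 addr0.
  rewrite -[0 in RHS](rmorph0 iota) => /iota_inj/eqP.
  by rewrite mulf_eq0 polyC_eq0 (negPf (monic_neq0 f_monic)) => /eqP.
have szP : (size P <= 1)%N.
  apply/leq_sizeP => [[|i]] // _; have /polyP/(_ i) := P'0.
  rewrite coef_deriv coef0 -mulr_natl -polyC_natr => /eqP.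
  by rewrite mulf_eq0 polyC_eq0 natK_eq0 => /eqP.
have fn_monic : f ^+ n \is monic by rewrite monic_exp.
pose q := (P`_0)%R %/ (f ^+ n); pose s := (P`_0)%R %% (f ^+ n); exists q.
have Pqs : P`_0 = q * f ^+ n + s := divp_eq _ _.
have lts : (size s < (n * r).+1)%N.
  by rewrite -(fX_top n).1 ltn_modpN0 ?monic_neq0.
have fbq : iota f%:P ^+ n * (b - iota q%:P) = iota s%:P.
  rewrite mulrBr fb (size1_polyC szP) Pqs iota_fX -rmorphM -rmorphB /=.
  by rewrite -polyCM -polyCB [f ^+ n * q]mulrC addrAC subrr add0r.
have [s0|s0] := eqVneq s 0.
  by apply/subr0_eq/(@f_regular n); rewrite fbq s0 rmorph0.
have ss : (0 < size s)%N by rewrite size_poly_gt0.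
have s_lead : leading (b - iota q%:P) ((size s).-1%:Z - (n * r)%:Z) 0 (lead_coef s).
  exists n, (size s).-1, s%:P; rewrite coefC eqxx -lead_coefE prednK //.
  by split=> //; exact: size_polyC_leq1.
have := leading_range s_lead; rewrite lead_coef_eq0 => /(_ s0).
by rewrite div0n muln0; lia.
Qed.

End Triangular.

End ReducedForms.

(** * The quotient ring *)
Lemma monic_poly_monic (R : nzRingType) n (c : 'I_n -> R) : monic_poly c \is monic.
Proof.
rewrite monicE lead_coefE size_monic_poly /= coefD coefXn eqxx coef_sum big1 ?addr0 //.
by move=> i _; rewrite coefZ coefXn gtn_eqF ?mulr0.
Qed.

Section Quotient.
Variables (K : closedFieldType) (r d : nat) (a : 'I_r -> K) (b : 'I_d -> {poly K}).
Variables (d_gt1 : (1 < d)%N).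
Let f := monic_poly a.
Let phi := monic_poly b.
Let g := danielewski_poly f phi.
Local Notation B := (danielewski_ring f b d_gt1).
Local Notation proj := (danielewski_proj f b d_gt1).
Local Notation T := {poly {poly {poly K}}}.

Fact proj_is_zmod_morphism : zmod_morphism proj.
Proof. exact: rmorphB. Qed.

Fact proj_is_monoid_morphism : monoid_morphism proj.
Proof. by split; [exact: rmorph1|exact: rmorphM]. Qed.

HB.instance Definition _ := GRing.isZmodMorphism.Build T B proj proj_is_zmod_morphism.
HB.instance Definition _ := GRing.isMonoidMorphism.Build T B proj proj_is_monoid_morphism.

Lemma proj_eq0 p : proj p = 0 <-> exists q, p = q * g.
Proof. exact: principal_quot_eq0. Qed.

Lemma proj_repr (u : B) : proj (repr u) = u.
Proof. exact: reprK. Qed.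

Definition embedXZ : {poly {poly K}} -> B := proj \o map_poly polyC.
HB.instance Definition _ := GRing.RMorphism.on embedXZ.

Let y : B := proj 'X%:P.

Lemma embedXZ_phi : embedXZ f%:P * y = embedXZ phi.
Proof.
apply/eqP; rewrite -subr_eq0 /embedXZ /= /y -rmorphM -rmorphB.
apply/eqP/proj_eq0; exists 1.
by rewrite mul1r /g /danielewski_poly map_polyC.
Qed.

Lemma swapXY_g : swapXY g = f%:P *: 'X - phi%:P.
Proof.
rewrite rmorphB rmorphM /= swapXY_map_polyC !swapXY_polyC map_polyC map_polyX.
by rewrite mul_polyC.
Qed.

(** Seen as a polynomial in Y over K[X][Z], the relation has degree 1, whereas
    the elements of K[X][Z] have degree 0. *)
Lemma embedXZ_inj : injective embedXZ.
Proof.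
apply: raddf_inj => P /proj_eq0[q /(congr1 swapXY)].
rewrite swapXY_map_polyC rmorphM /= swapXY_g => Pq.
have f0 : f%:P != 0 :> {poly {poly K}}.
  by rewrite polyC_eq0 monic_neq0 ?monic_poly_monic.
have szg : size (f%:P *: 'X - phi%:P : T) = 2%N.
  rewrite size_polyDl size_scale ?size_polyX // size_polyN.
  by rewrite (leq_ltn_trans (size_polyC_leq1 _)).
have [q0|q0] := eqVneq (swapXY q) 0.
  by apply: polyC_inj; rewrite Pq q0 mul0r.
have g0 : (f%:P *: 'X - phi%:P : T) != 0 by rewrite -size_poly_gt0 szg.
have := size_polyC_leq1 P.
by rewrite Pq size_mul // szg addn2 /= ltnS leqn0 size_poly_eq0 (negPf q0).
Qed.

Lemma proj_swapXY W : proj (swapXY W) = (map_poly embedXZ W).[y].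
Proof.
elim/poly_ind: W => [|W P IHW]; first by rewrite !rmorph0 horner0.
rewrite !rmorphD !rmorphM /= swapXY_polyC swapXY_X hornerD hornerM IHW.
by rewrite map_polyX map_polyC hornerX hornerC.
Qed.

(** Up to sign the relation is monic in Z of degree d, so representatives can
    be reduced modulo it to degree less than d in Z. *)
Lemma reduced_form (u : B) : exists2 W : T,
  (forall j, (size (W`_j)%R <= d)%N) & u = (map_poly embedXZ W).[y].
Proof.
have g_monic : - g \is monic.
  have szphi : size (map_poly polyC phi : T) = d.+1.
    by rewrite size_map_inj_poly ?size_monic_poly //; exact: polyC_inj.
  rewrite /g /danielewski_poly opprB monicE lead_coefDl.
    by rewrite lead_coef_map_inj ?(monicP (monic_poly_monic b)) //; exact: polyC_inj.
  rewrite szphi size_polyN -polyCM (leq_ltn_trans (size_polyC_leq1 _)) //.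
  by rewrite ltnS ltnW.
have szg : size (- g) = d.+1.
  rewrite /g /danielewski_poly opprB size_polyDl size_map_inj_poly ?size_monic_poly //;
    do 1?exact: polyC_inj.
  rewrite size_polyN -polyCM (leq_ltn_trans (size_polyC_leq1 _)) //.
  by rewrite ltnS ltnW.
pose Q := Pdiv.Ring.rmodp (repr u) (- g).
have szQ : (size Q <= d)%N.
  by rewrite -ltnS -szg Pdiv.Ring.ltn_rmodpN0 ?monic_neq0.
exists (swapXY Q) => [j|].
  apply/leq_sizeP => i ledi.
  by rewrite coef_swapXY [Q`_i]nth_default ?coef0 // (leq_trans szQ).
rewrite -proj_swapXY swapXYK -[LHS]proj_repr (Pdiv.RingMonic.rdivp_eq g_monic (repr u)).
rewrite rmorphD /= [X in X + _](_ : _ = 0) ?add0r //.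
by apply/proj_eq0; exists (- Pdiv.Ring.rdivp (repr u) (- g)); rewrite mulNr mulrN.
Qed.

(** Conjugating by the exchange of Y and Z makes this a derivation by mere
    transport of the formal derivative. *)
Definition partialY (p : T) : T := swapXY (swapXY p)^`().

Definition triangular_lift (p : T) : T :=
  f%:P%:P * p^`() + map_poly polyC phi^`() * partialY p.

Lemma partialYD p q : partialY (p + q) = partialY p + partialY q.
Proof. by rewrite /partialY rmorphD derivD rmorphD. Qed.

Lemma partialYM p q : partialY (p * q) = partialY p * q + p * partialY q.
Proof. by rewrite /partialY rmorphM derivM rmorphD !rmorphM /= !swapXYK. Qed.

Lemma triangular_lift_derivation : derivation triangular_lift.
Proof.
split=> p q; rewrite /triangular_lift; first by rewrite derivD partialYD; ring.
by rewrite derivM partialYM; ring.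
Qed.

Lemma partialY_map_polyC P : partialY (map_poly polyC P) = 0.
Proof. by rewrite /partialY swapXY_map_polyC derivC rmorph0. Qed.

(** Hence the lift preserves the ideal generated by the relation. *)
Lemma triangular_lift_g : triangular_lift g = 0.
Proof.
rewrite /triangular_lift.
have -> : partialY g = f%:P%:P.
  rewrite /partialY swapXY_g derivB derivZ derivX derivC subr0.
  by rewrite -mul_polyC mulr1 swapXY_polyC map_polyC.
rewrite /g /danielewski_poly derivB -polyCM derivC deriv_map; ring.
Qed.

Definition triangular_derivation (u : B) : B := proj (triangular_lift (repr u)).

Lemma triangular_derivation_proj p :
  triangular_derivation (proj p) = proj (triangular_lift p).
Proof.
have derT := triangular_lift_derivation.
have /proj_eq0[q eq_q] : proj (repr (proj p) - p) = 0.
  by rewrite rmorphB /= proj_repr subrr.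
rewrite /triangular_derivation -[repr _](subrK p) eq_q (derivationD derT).
rewrite (derivationM derT) triangular_lift_g mulr0 addr0 rmorphD /=.
by rewrite [X in X + _](_ : _ = 0) ?add0r //; apply/proj_eq0; eexists.
Qed.

Lemma triangular_derivation_derivation : derivation triangular_derivation.
Proof.
have derT := triangular_lift_derivation.
split=> u v; rewrite -[u]proj_repr -[v]proj_repr.
  by rewrite -rmorphD !triangular_derivation_proj (derivationD derT) rmorphD.
rewrite -rmorphM !triangular_derivation_proj (derivationM derT) rmorphD.
by rewrite !rmorphM.
Qed.

Lemma triangular_derivation_embedXZ P :
  triangular_derivation (embedXZ P) = embedXZ (f%:P * P^`()).
Proof.
rewrite /embedXZ /= triangular_derivation_proj /triangular_lift partialY_map_polyC.
by rewrite mulr0 addr0 deriv_map [map_poly _ (_ * _)]rmorphM /= map_polyC.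
Qed.

Lemma triangular_derivation_y : triangular_derivation y = embedXZ phi^`().
Proof.
rewrite triangular_derivation_proj /triangular_lift derivC mulr0 add0r.
by rewrite /partialY swapXY_polyC map_polyX derivX rmorph1 mulr1.
Qed.

Lemma embedXZ_polyC p :
  embedXZ p%:P = (map_poly (danielewski_const f b d_gt1) p).[danielewski_x f b d_gt1].
Proof.
elim/poly_ind: p => [|p c IHp]; first by rewrite polyC0 !rmorph0 map_poly0 horner0.
have c0 : danielewski_const f b d_gt1 0 = 0 by rewrite /danielewski_const !polyC0 rmorph0.
have -> : map_poly (danielewski_const f b d_gt1) (p * 'X + c%:P) =
   map_poly (danielewski_const f b d_gt1) p * 'X + (danielewski_const f b d_gt1 c)%:P.
  apply/polyP => i; rewrite coef_map_id0 // !coefD !coefMX !coefC coef_map_id0 //.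
  by case: i => [|i] /=; rewrite ?add0r ?addr0.
rewrite hornerMXaddC -IHp polyCD polyCM rmorphD rmorphM.
have embedC (q : {poly K}) : embedXZ q%:P = proj q%:P%:P by rewrite /embedXZ /= map_polyC.
by rewrite /= !embedC.
Qed.

End Quotient.

Theorem theorem7 (K : closedFieldType) (charK0 : [pchar K] =i pred0)
    (r d : nat) (a : 'I_r -> K) (b : 'I_d -> {poly K})
    (r_gt1 : (1 < r)%N) (d_gt1 : (1 < d)%N) :
  ML (danielewski_ring (monic_poly a) b d_gt1)
    = danielewski_Kx (monic_poly a) b d_gt1.
Proof.
have f_monic := monic_poly_monic a; have size_f := size_monic_poly a.
have phi_monic := monic_poly_monic b; have size_phi := size_monic_poly b.
have inj := @embedXZ_inj _ _ _ a b d_gt1.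
have rel := embedXZ_phi a b d_gt1.
have red := @reduced_form _ _ _ a b d_gt1.
apply/seteqP; split => [u MLu|_ [p _ <-] D derD nilD].
  have derT := triangular_derivation_derivation a b d_gt1.
  have T_embed := triangular_derivation_embedXZ a b d_gt1.
  have nilT := triangular_nilpotent red derT T_embed (triangular_derivation_y a b d_gt1).
  have [p ->] := triangular_kernel r_gt1 d_gt1 f_monic size_f phi_monic size_phi
    inj rel red charK0 derT T_embed (MLu _ derT nilT).
  by exists p => //; exact/esym/embedXZ_polyC.
rewrite -embedXZ_polyC (derivation_iota r_gt1 d_gt1 f_monic size_f phi_monic size_phi
  inj rel red charK0 derD nilD) derivC rmorph0 mul0r addr0.
by rewrite (derivation_x0 r_gt1 d_gt1 f_monic size_f phi_monic size_phi
  inj rel red charK0 derD nilD) mulr0.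
Qed.
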